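(* Let $G$ be a locally compact second countable group and let $\Lambda\subseteq G$ be a point set of finite local complexity. Then the groupoid $\mathcal{G}(\Lambda)$ of $\Lambda$ is inner amenable.
   Context: Throughout, $G$ is a second countable locally compact (Hausdorff) group with identity $e$. Let $\mathcal{C}(G)$ be the space of all closed subsets of $G$ with the Chabauty-Fell topology, whose subbasis consists of the sets $O_K=\{C\in\mathcal{C}(G)\mid C\cap K=\emptyset\}$ for $K\subseteq G$ compact and $O_U=\{C\in\mathcal{C}(G)\mid C\cap U\neq\emptyset\}$ for $U\subseteq G$ open. The group $G$ acts continuously on $\mathcal{C}(G)$ by left translation. A point set $\Lambda$ in $G$ is an element of $\mathcal{C}(G)$, i.e. a closed subset of $G$. The hull of $\Lambda$ is $\Omega(\Lambda)=\overline{\{g\Lambda\mid g\in G\}}\subseteq\mathcal{C}(G)$, and the discrete hull of $\Lambda$ is $\Omega_0(\Lambda)=\{P\in\Omega(\Lambda)\mid e\in P\}$; both carry the subspace topology and are compact. Finite local complexity (FLC): $\Lambda$ has finite local complexity if for every compact $K\subseteq G$ there is a finite collection $\mathcal{F}$ of finite subsets of $G$ such that for every $P\in\Omega_0(\Lambda)$ there exist $h\in G$ and $F\in\mathcal{F}$ with $K\cap P=hF$. The groupoid of $\Lambda$ is the restriction of the transformation groupoid $G\ltimes\Omega(\Lambda)$ to the set of units $\Omega_0(\Lambda)$. Explicitly, $\mathcal{G}(\Lambda)=\{(x,P)\in G\times\Omega_0(\Lambda)\mid x^{-1}\in P\}$ with the subspace topology from $G\times\Omega_0(\Lambda)$, unit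 space $\Omega_0(\Lambda)$ (with $P$ identified with $(e,P)$), source $s(x,P)=P$, range $r(x,P)=xP$, inverse $(x,P)^{-1}=(x^{-1},xP)$ and multiplication $(y,xP)(x,P)=(yx,P)$. Inner amenability: let $\mathcal{G}$ be a locally compact Hausdorff groupoid with unit space $\mathcal{G}^{(0)}$ and range map $r$; for a unit $x$ write $\mathcal{G}^x=r^{-1}(x)$. A function $f:\mathcal{G}\times\mathcal{G}\to\mathbb{C}$ is properly supported if for every compact $K\subseteq\mathcal{G}$ the sets $\mathrm{supp}(f)\cap(K\times\mathcal{G})$ and $\mathrm{supp}(f)\cap(\mathcal{G}\times K)$ are compact. It is of positive type if for all units $x,y\in\mathcal{G}^{(0)}$, all $n\geq 1$, and all $\gamma_1,\dots,\gamma_n\in\mathcal{G}^x$ and $\eta_1,\dots,\eta_n\in\mathcal{G}^y$, the $n\times n$ matrix $\big(f(\gamma_i^{-1}\gamma_j,\eta_i^{-1}\eta_j)\big)_{i,j}$ is positive (i.e. positive semidefinite). The groupoid $\mathcal{G}$ is inner amenable if for every compact $K\subseteq\mathcal{G}$ and every $\epsilon>0$ there is a continuous, properly supported function $f$ of positive type on $\mathcal{G}\times\mathcal{G}$ with $|f(\gamma,\gamma)-1|<\epsilon$ for all $\gamma\in K$. *)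

(* Defs.v *)
From HB Require Import structures.
From mathcomp Require Import all_boot all_order all_algebra finmap.
From mathcomp Require Import all_classical all_reals all_analysis.
From mathcomp Require Import complex.
Set Implicit Arguments.
Unset Strict Implicit.
Unset Printing Implicit Defensive.
Import Order.TTheory GRing.Theory Num.Theory.
Import numFieldNormedType.Exports.

Local Open Scope classical_set_scope.
Local Open Scope group_scope.

HB.mixin Record isTopologicalGroup G & Topological G & Group G := {
  mulg_continuous : continuous (fun xy : G * G => xy.1 * xy.2);
  invg_continuous : continuous (fun x : G => x^-1)
}.

#[short(type="topologicalGroupType")]
HB.structure Definition TopologicalGroup :=
  {G of Topological G & Group G & isTopologicalGroup G}.

Section Composable.
Variables (U A : Type) (s r : A -> U).

Definition composable : set (A * A) := [set ab | s ab.1 = r ab.2].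

Definition composite (m : composable -> A) (a b : A) (h : s a = r b) : A :=
  m (exist _ (a, b) (mem_set (h : composable (a, b)))).

End Composable.

(* Locally compact Hausdorff groupoids. The unit space is a separate type,
   embedded in the arrows by [gid], a homeomorphism onto its image since [gsrc]
   is a continuous left inverse. The product is only defined on composable
   pairs, whose set carries the subspace topology. *)
Record lchGroupoid := LCHGroupoid {
  gunit : topologicalType;
  garrow :> topologicalType;
  gsrc : garrow -> gunit;
  grng : garrow -> gunit;
  gid : gunit -> garrow;
  ginv : garrow -> garrow;
  gmul : composable gsrc grng -> garrow;
  gsrc_id : forall x, gsrc (gid x) = x;
  grng_id : forall x, grng (gid x) = x;
  gsrc_inv : forall a, gsrc (ginv a) = grng a;
  grng_inv : forall a, grng (ginv a) = gsrc a;
  gsrc_mul : forall ab, gsrc (gmul ab) = gsrc (set_val ab).2;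
  grng_mul : forall ab, grng (gmul ab) = grng (set_val ab).1;
  gmulA : forall a b c (hab : gsrc a = grng b) (hbc : gsrc b = grng c)
    (habc : gsrc a = grng (composite gmul hbc))
    (habc' : gsrc (composite gmul hab) = grng c),
    composite gmul habc = composite gmul habc';
  gmul1g : forall a (h : gsrc (gid (grng a)) = grng a), composite gmul h = a;
  gmulg1 : forall a (h : gsrc a = grng (gid (gsrc a))), composite gmul h = a;
  gmulVg : forall a (h : gsrc (ginv a) = grng a),
    composite gmul h = gid (gsrc a);
  gmulgV : forall a (h : gsrc a = grng (ginv a)),
    composite gmul h = gid (grng a);
  gsrc_continuous : continuous gsrc;
  grng_continuous : continuous grng;
  gid_continuous : continuous gid;
  ginv_continuous : continuous ginv;
  gmul_continuous : continuous gmul;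
  garrow_hausdorff : hausdorff_space garrow;
  garrow_locally_compact : locally_compact [set: garrow]
}.

Section InnerAmenable.
Local Open Scope ring_scope.
Variables (R : realType) (X : lchGroupoid).

Definition rfiber (x : gunit X) : set X := [set a | grng a = x].

Lemma rfiber_composable x (a b : rfiber x) :
  gsrc (ginv (set_val a)) = grng (set_val b).
Proof.
by rewrite gsrc_inv; case: a b => a /= /set_mem ->; case=> b /= /set_mem ->.
Qed.

(* The arrow a^-1 b, for a and b with the same range. *)
Definition ldiv x (a b : rfiber x) : X :=
  composite (@gmul X) (rfiber_composable a b).

Definition supp (f : X * X -> R[i]) : set (X * X) :=
  closure [set p | f p != 0].

Definition properly_supported (f : X * X -> R[i]) : Prop :=
  forall K : set X, compact K ->
    compact (supp f `&` (K `*` setT)) /\ compact (supp f `&` (setT `*` K)).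

(* In the order of R[i], [0 <= z] says that z is real and nonnegative; hence
   the matrices below are in particular hermitian. *)
Definition psdmx n (M : 'M[R[i]]_n) : Prop :=
  forall c : 'I_n -> R[i], 0 <= \sum_i \sum_j (c i)^* * M i j * c j.

Definition positive_type (f : X * X -> R[i]) : Prop :=
  forall (x y : gunit X) (n : nat), (0 < n)%N ->
  forall (a : 'I_n -> rfiber x) (b : 'I_n -> rfiber y),
    psdmx (\matrix_(i < n, j < n) f (ldiv (a i) (a j), ldiv (b i) (b j))).

Definition inner_amenable : Prop :=
  forall (K : set X) (e : R), compact K -> 0 < e ->
  exists f : X * X -> R[i],
    [/\ continuous (f : X * X -> R[i]^o), properly_supported f,
        positive_type f & forall a, K a -> `|f (a, a) - 1| < (e%:C)%C].

End InnerAmenable.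

Record closedSet (T : topologicalType) := ClosedSet {
  closedSet_val :> set T;
  closedSet_closed : closed closedSet_val
}.

HB.instance Definition _ (T : topologicalType) :=
  gen_eqMixin (closedSet T).
HB.instance Definition _ (T : topologicalType) :=
  gen_choiceMixin (closedSet T).

Lemma closedSetP (T : topologicalType) (C D : closedSet T) :
  (C : set T) = D -> C = D.
Proof.
case: C D => [C cC] [D cD] /= CD; subst D; congr ClosedSet.
exact: Prop_irrelevance.
Qed.

Section ChabautyFell.
Variable T : topologicalType.

Definition missing (K : set T) : set (closedSet T) :=
  [set C : closedSet T | C `&` K = set0].

Definition hitting (U : set T) : set (closedSet T) :=
  [set C : closedSet T | C `&` U !=set0].

Definition chabauty_fell_subbase : set (set (closedSet T)) :=
  [set missing K | K in compact] `|` [set hitting U | U in open].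

HB.instance Definition _ :=
  isSubBaseTopological.Build (closedSet T) chabauty_fell_subbase id.

End ChabautyFell.

Section PointSets.
Variable G : topologicalGroupType.

Lemma closed_lmul (g : G) (C : closedSet G) : closed [set g * x | x in C].
Proof.
have -> : [set g * x | x in C] = (fun x => g^-1 * x) @^-1` C.
  apply/seteqP; split=> [_ [x Cx <-]|x Cx] /=; first by rewrite mulKg.
  by exists (g^-1 * x); rewrite ?mulVKg.
apply: preimage_closed; last exact: closedSet_closed.
move=> x _; apply: (@continuous_comp _ _ _ (fun x : G => (g^-1, x))
  (fun xy : G * G => xy.1 * xy.2)); last exact: mulg_continuous.
by apply: cvg_pair => /=; [exact: cvg_cst|exact: cvg_id].
Qed.

Definition translate (g : G) (C : closedSet G) : closedSet G :=
  ClosedSet (closed_lmul (g := g) (C := C)).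

Definition hull (L : closedSet G) : set (closedSet G) :=
  closure [set translate g L | g in [set: G]].

Definition discrete_hull (L : closedSet G) : set (closedSet G) :=
  [set P | hull L P /\ (P : set G) 1].

Definition finite_local_complexity (L : closedSet G) : Prop :=
  forall K : set G, compact K ->
  exists2 F : set (set G), finite_set F & F `<=` finite_set /\
    forall P, discrete_hull L P ->
      exists (h : G) (E : set G), F E /\ K `&` P = [set h * x | x in E].

Definition gpd_arrow (L : closedSet G) : set (G * discrete_hull L)%type :=
  [set xP | closedSet_val (set_val xP.2) xP.1^-1].

End PointSets.

Arguments gpd_arrow {G} L _.

Section SubtypeTopology.
Variables (X : topologicalType) (A : set X).

Lemma continuous_set_val : continuous (@set_val X A).
Proof. exact: initial_continuous. Qed.

Lemma continuous_to_set_type (Y : topologicalType) (f : Y -> A) :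
  continuous (set_val \o f) -> continuous f.
Proof. exact: (@continuous_comp_initial A Y X set_val f). Qed.

Lemma set_type_hausdorff : hausdorff_space X -> hausdorff_space A.
Proof.
move=> hX p q clpq; apply: val_inj; apply: hX => U V pU qV.
have [z [Uz Vz]] := clpq _ _ (@continuous_set_val p U pU)
  (@continuous_set_val q V qV).
by exists (set_val z).
Qed.

Lemma set_type_compact (K : set X) :
  closed A -> compact K -> compact (@set_val X A @^-1` K).
Proof.
move=> clA cK F FF FK.
have [p [Kp /= clp]] := cK (set_val @ F) (fmap_proper_filter _ FF) FK.
have Ap : A p.
  apply: clA => U Up.
  have : (set_val @ F) A.
    by apply: (@filterE _ F) => x; exact: (set_mem (valP x)).
  by move=> /clp; apply.
exists (exist _ p (mem_set Ap)); split => //= B V FB [_ [[W oW <-] /= Wp WV]].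
have : (set_val @ F) [set set_val b | b in B].
  by apply: (@filterS _ F _ _ _ _ FB) => b Bb; exists b.
move=> /clp/(_ (open_nbhs_nbhs (conj oW Wp))) [_ [[b Bb <-] Wb]].
by exists b; split => //; exact: WV.
Qed.

End SubtypeTopology.

Lemma continuous_comp2 (X U V W : topologicalType) (f : X -> U) (g : X -> V)
    (h : U -> V -> W) :
  continuous (fun z : U * V => h z.1 z.2) -> continuous f -> continuous g ->
  continuous (fun x => h (f x) (g x)).
Proof.
move=> ch cf cg x.
exact: (@continuous2_cvg _ U V W (nbhs x) _ f g h (f x) (g x)
  (ch (f x, g x)) (cf x) (cg x)).
Qed.

Lemma continuous_pair (X U V : topologicalType) (f : X -> U) (g : X -> V) :
  continuous f -> continuous g -> continuous (fun x => (f x, g x)).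
Proof. by move=> cf cg x; apply: cvg_pair; [exact: cf|exact: cg]. Qed.

Lemma prod_hausdorff (X Y : topologicalType) :
  hausdorff_space X -> hausdorff_space Y -> hausdorff_space (X * Y)%type.
Proof.
move=> hX hY [x y] [x' y'] cl; congr pair.
- apply: hX => U V xU x'V.
  have [] := cl (fst @^-1` U) (fst @^-1` V).
  + exact: (@cvg_fst _ _ (nbhs x) (nbhs y) _ U xU).
  + exact: (@cvg_fst _ _ (nbhs x') (nbhs y') _ V x'V).
  by move=> z [? ?]; exists z.1.
- apply: hY => U V yU y'V.
  have [] := cl (snd @^-1` U) (snd @^-1` V).
  + exact: (@cvg_snd _ _ (nbhs x) (nbhs y) _ U yU).
  + exact: (@cvg_snd _ _ (nbhs x') (nbhs y') _ V y'V).
  by move=> z [? ?]; exists z.2.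
Qed.

Lemma compact_nbhs_sub (T : topologicalType) (x : T) (V : set T) :
  hausdorff_space T -> locally_compact [set: T] -> nbhs x V ->
  exists N, [/\ nbhs x N, compact N & N `<=` V].
Proof.
move=> hT lcT xV; have [K xK [cK clK]] := lcT x I.
have {}xK : nbhs x K.
  by apply: (@filterS _ (nbhs x) _ _ _ _ xK) => y; apply.
have [M xM MV] := compact_regular hT cK xK xV.
exists (closure M `&` K); split.
- apply: filterI => //; apply: (@filterS _ (nbhs x) _ _ _ _ xM).
  exact: subset_closure.
- by rewrite setIC; apply: compact_closedI cK _; exact: closed_closure.
- by move=> y [/MV].
Qed.

Section ChabautyFellTheory.
Variable T : topologicalType.

Lemma open_subbase (A : set (closedSet T)) :
  chabauty_fell_subbase A -> open A.
Proof.
move=> sA; exists [set A]; last first.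
  by rewrite predeqE => ?; split=> [[_ ->]|] //; exists A.
move=> _ ->; exists [fset A]%fset.
  by move=> ?; rewrite inE inE => /eqP ->.
by rewrite predeqE => ?; split=> [|??]; [apply|]; rewrite /= inE // =>/eqP ->.
Qed.

Lemma open_missing (K : set T) : compact K -> open (missing K).
Proof. by move=> cK; apply: open_subbase; left; exists K. Qed.

Lemma open_hitting (U : set T) : open U -> open (hitting U).
Proof. by move=> oU; apply: open_subbase; right; exists U. Qed.

Lemma cvg_closedSet (F : set_system (closedSet T)) (C : closedSet T) :
  Filter F ->
  (forall K, compact K -> missing K C -> F (missing K)) ->
  (forall U, open U -> hitting U C -> F (hitting U)) ->
  F --> C.
Proof.
move=> FF hK hU A; rewrite nbhsE.
move=> [_ [[B sB <-] [D BD DC] sUBA]].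
rewrite nbhs_filterE; apply: filterS sUBA _; apply: (@filterS _ _ _ D).
  by move=> ? ?; exists D.
have /sB [E sE IED] := BD; rewrite -IED; apply: filter_bigI => S ES.
have SC : S C by move: DC; rewrite -IED => /(_ _ ES).
have := sE _ ES; rewrite inE => -[[K cK KS]|[U oU US]]; subst S.
- exact: hK.
- exact: hU.
Qed.

Lemma closedSet_compact : compact [set: closedSet T].
Proof.
rewrite compact_ultra => F FU _.
have FP : ProperFilter F by exact: ultra_proper.
pose C := [set x : T | forall U, open U -> U x -> F (hitting U)].
have clC : closed C.
  move=> x clx U oU Ux.
  have [y [Cy Uy]] := clx U (open_nbhs_nbhs (conj oU Ux)).
  exact: Cy oU Uy.
exists (ClosedSet clC); split => //=; apply: cvg_closedSet => [K cK KC|U oU].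
  have : \forall D \near F, K `<=` ~` (D : closedSet T).
    move/compact_near_coveringP : cK; apply => x Kx.
    have nCx : ~ C x by move=> Cx; have : set0 x by rewrite -KC.
    move/existsNP : nCx => [U /not_implyP[oU /not_implyP[Ux nFU]]].
    have [//|FnU] := in_ultra_setVsetC (hitting U) FU.
    exists (U, ~` hitting U) => /=.
      by split => //; exact: (open_nbhs_nbhs (conj oU Ux)).
    by move=> [y D] /= [Uy nUD] Dy; apply: nUD; exists y.
  apply: filterS => D KD; rewrite /missing /=.
  by apply/seteqP; split => // y [Dy /KD].
by move=> [x [Cx Ux]]; exact: Cx oU Ux.
Qed.

Lemma closedSet_hausdorff : hausdorff_space T -> locally_compact [set: T] ->
  hausdorff_space (closedSet T).
Proof.
move=> hT lcT.
have sub (C D : closedSet T) : cluster (nbhs C) D -> C `<=` D.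
  move=> cl x Cx; apply: contrapT => nDx.
  have [N [xN cN ND]] : exists N, [/\ nbhs x N, compact N & N `<=` ~` D].
    apply: compact_nbhs_sub => //; apply: open_nbhs_nbhs; split => //.
    exact/closed_openC/closedSet_closed.
  have [] := cl (hitting N°) (missing N).
  - apply: open_nbhs_nbhs; split; first exact/open_hitting/open_interior.
    by exists x.
  - apply: open_nbhs_nbhs; split; first exact: open_missing.
    by apply/seteqP; split => // y [Dy /ND].
  move=> E [[y [Ey /interior_subset Ny]]]; rewrite /missing /= => EN.
  by have : set0 y by rewrite -EN.
move=> C D cl; apply: closedSetP; apply/seteqP; split; apply: sub => //.
by move=> A B CA DB; rewrite setIC; exact: cl.
Qed.

End ChabautyFellTheory.

Section HullTheory.
Variable G : topologicalGroupType.
Hypothesis hG : hausdorff_space G.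
Hypothesis lcG : locally_compact [set: G].

Lemma translateE (g x : G) (C : closedSet G) :
  (translate g C : set G) x <-> (C : set G) (g^-1 * x).
Proof.
split=> [[y Cy <-]|Cx]; first by rewrite mulKg.
by exists (g^-1 * x); rewrite ?mulVKg.
Qed.

Lemma translate1 (C : closedSet G) : translate 1 C = C.
Proof.
by apply: closedSetP; apply/seteqP; split => x; rewrite translateE invg1 mul1g.
Qed.

Lemma translateM (g h : G) (C : closedSet G) :
  translate (g * h) C = translate g (translate h C).
Proof.
apply: closedSetP; apply/seteqP; split => x;
  by rewrite !translateE invgM mulgA.
Qed.

Lemma ldiv_continuous : continuous (fun yk : G * G => yk.1^-1 * yk.2).
Proof.
apply: (@continuous_comp2 (G * G)%type G G G (fun yk => yk.1^-1) snd
  (fun a b => a * b)).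
- exact: mulg_continuous.
- move=> yk; apply: (@continuous_comp _ _ _ fst (fun y : G => y^-1)).
    exact: cvg_fst.
  exact: invg_continuous.
- by move=> yk; exact: cvg_snd.
Qed.

Lemma translate_continuous :
  continuous (fun xC : G * closedSet G => translate xC.1 xC.2).
Proof.
move=> [x C] /=; apply: cvg_closedSet => [K cK KC|U oU [_ [[z Cz <-] Uxz]]].
- have : \forall yD \near (x, C), K `<=` ~` (translate yD.1 yD.2).
    apply: ((compact_near_coveringP K).1 cK _ (nbhs (x, C))
      (fun yD k => ~ (translate yD.1 yD.2 : set G) k)) => k Kk.
    have [N [xN cN NC]] :
        exists N, [/\ nbhs (x^-1 * k) N, compact N & N `<=` ~` C].
      apply: compact_nbhs_sub => //; apply: open_nbhs_nbhs; split.
        exact/closed_openC/closedSet_closed.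
      by move=> Cxk; have : set0 k by rewrite -KC; split => //; exact/translateE.
    have := @ldiv_continuous (x, k).
    move=> /(_ _ xN) [[A B] /= [xA kB] AB].
    exists (B, [set yD | A yD.1 /\ missing N yD.2]) => /=.
      split => //; exists (A, missing N) => //; split => //=.
      apply: open_nbhs_nbhs; split; first exact: open_missing.
      by apply/seteqP; split => // y [Cy /NC].
    move=> [k' [y D]] /= [Bk' [Ay ND]] /translateE Dyk'.
    have : set0 (y^-1 * k') by rewrite -ND; split => //; exact: (AB (y, k')).
    by [].
  apply: filterS => -[y D] /= KD; rewrite /missing /=.
  by apply/seteqP; split => // k [Dk /KD].
- have /(_ U) [] := @mulg_continuous G (x, z).
    exact: (open_nbhs_nbhs (conj oU Uxz)).
  move=> [A B] /= [xA zB] AB.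
  exists (A, hitting B°).
    split => //=; apply: open_nbhs_nbhs; split.
      exact/open_hitting/open_interior.
    by exists z.
  move=> [y D] /= [Ay [w [Dw /interior_subset Bw]]]; exists (y * w).
  by split; [exists w|exact: (AB (y, w))].
Qed.

Lemma hull_translate (L P : closedSet G) (g : G) :
  hull L P -> hull L (translate g P).
Proof.
move=> LP W gPW.
have : translate g Q @[Q --> P] --> translate g P.
  apply: (@continuous2_cvg _ G (closedSet G) (closedSet G) (nbhs P) _
    (fun=> g) id (fun x C => translate x C)).
  - exact: (@translate_continuous (g, P)).
  - exact: cvg_cst.
  - exact: cvg_id.
move=> /(_ _ gPW) /LP [_ [[h _ <-] Wgh]].
exists (translate g (translate h L)); split => //.
by exists (g * h) => //; rewrite translateM.
Qed.

Lemma closed_discrete_hull (L : closedSet G) : closed (discrete_hull L).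
Proof.
apply: closedI; first exact: closed_closure.
rewrite -openC [X in open X](_ : _ = missing [set (1 : G)]).
  by apply: open_missing; exact: compact_set1.
apply/seteqP; split => P; rewrite /missing /=.
  by move=> nP1; apply/seteqP; split => // x [Px x1]; apply: nP1; rewrite -x1.
by move=> P1 Pe; have : (set0 : set G) 1 by rewrite -P1.
Qed.

End HullTheory.

Section Groupoid.
Variable G : topologicalGroupType.
Hypothesis hG : hausdorff_space G.
Hypothesis lcG : locally_compact [set: G].
Variable L : closedSet G.

Lemma gpd_rng_subproof (a : gpd_arrow L) :
  translate (set_val a).1 (set_val (set_val a).2) \in discrete_hull L.
Proof.
case: a => -[x P] /= /set_mem /= xP; apply/mem_set; split.
  by apply: hull_translate => //; have [] := set_mem (valP P).
by apply/translateE; rewrite mulg1.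
Qed.

Definition gpd_src (a : gpd_arrow L) : discrete_hull L := (set_val a).2.

Definition gpd_rng (a : gpd_arrow L) : discrete_hull L :=
  exist (fun P => P \in discrete_hull L) _ (gpd_rng_subproof a).

Lemma gpd_id_subproof (P : discrete_hull L) : (1, P) \in gpd_arrow L.
Proof.
by apply/mem_set; rewrite /gpd_arrow /= invg1; have [] := set_mem (valP P).
Qed.

Definition gpd_id (P : discrete_hull L) : gpd_arrow L :=
  exist (fun a => a \in gpd_arrow L) _ (gpd_id_subproof P).

Lemma gpd_inv_subproof (a : gpd_arrow L) :
  ((set_val a).1^-1, gpd_rng a) \in gpd_arrow L.
Proof.
apply/mem_set; rewrite /gpd_arrow /= invgK; apply/translateE.
by rewrite mulVg; have [] := set_mem (valP (gpd_src a)).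
Qed.

Definition gpd_inv (a : gpd_arrow L) : gpd_arrow L :=
  exist (fun a => a \in gpd_arrow L) _ (gpd_inv_subproof a).

Lemma gpd_mul_subproof (ba : composable gpd_src gpd_rng) :
  ((set_val (set_val ba).1).1 * (set_val (set_val ba).2).1,
   gpd_src (set_val ba).2) \in gpd_arrow L.
Proof.
case: ba => -[b a] /= /set_mem /= ba; apply/mem_set.
rewrite /gpd_arrow /=.
have := set_mem (valP b); rewrite /gpd_arrow /= -/(gpd_src b) ba /=.
by move=> /translateE; rewrite invgM.
Qed.

(* (y, xP) (x, P) = (yx, P) *)
Definition gpd_mul (ba : composable gpd_src gpd_rng) : gpd_arrow L :=
  exist (fun a => a \in gpd_arrow L) _ (gpd_mul_subproof ba).

Lemma gpd_arrowP (a b : gpd_arrow L) :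
  (set_val a).1 = (set_val b).1 -> gpd_src a = gpd_src b -> a = b.
Proof.
rewrite /gpd_src => h1 h2; apply: val_inj; move: h1 h2.
by rewrite !set_valE; case: (val a) (val b) => [x P] [y Q] /= -> ->.
Qed.

Lemma gpd_rng_id P : gpd_rng (gpd_id P) = P.
Proof. by apply: val_inj => /=; rewrite translate1. Qed.

Lemma gpd_rng_inv a : gpd_rng (gpd_inv a) = gpd_src a.
Proof. by apply: val_inj => /=; rewrite -translateM mulVg translate1. Qed.

Lemma gpd_rng_mul ba : gpd_rng (gpd_mul ba) = gpd_rng (set_val ba).1.
Proof.
case: ba => -[b a] ba; apply: val_inj => /=; rewrite translateM.
have /= := set_mem ba; rewrite /composable /= => h.
by congr translate; rewrite -[RHS]/(set_val (gpd_src b)) h.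
Qed.

Lemma gpd_mulA a b c (hab : gpd_src a = gpd_rng b) (hbc : gpd_src b = gpd_rng c)
    (habc : gpd_src a = gpd_rng (composite gpd_mul hbc))
    (habc' : gpd_src (composite gpd_mul hab) = gpd_rng c) :
  composite gpd_mul habc = composite gpd_mul habc'.
Proof. by apply: gpd_arrowP => //=; rewrite mulgA. Qed.

Lemma gpd_mul1g a (h : gpd_src (gpd_id (gpd_rng a)) = gpd_rng a) :
  composite gpd_mul h = a.
Proof. by apply: gpd_arrowP => //=; rewrite mul1g. Qed.

Lemma gpd_mulg1 a (h : gpd_src a = gpd_rng (gpd_id (gpd_src a))) :
  composite gpd_mul h = a.
Proof. by apply: gpd_arrowP => //=; rewrite mulg1. Qed.

Lemma gpd_mulVg a (h : gpd_src (gpd_inv a) = gpd_rng a) :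
  composite gpd_mul h = gpd_id (gpd_src a).
Proof. by apply: gpd_arrowP => //=; rewrite mulVg. Qed.

Lemma gpd_mulgV a (h : gpd_src a = gpd_rng (gpd_inv a)) :
  composite gpd_mul h = gpd_id (gpd_rng a).
Proof. by apply: gpd_arrowP => //=; rewrite mulgV. Qed.

Let fst_arrow_continuous : continuous (fun a : gpd_arrow L => (set_val a).1).
Proof.
move=> a; apply: (@continuous_comp _ _ _ set_val fst).
  exact: continuous_set_val.
exact: cvg_fst.
Qed.

Lemma gpd_src_continuous : continuous gpd_src.
Proof.
move=> a; apply: (@continuous_comp _ _ _ set_val snd).
  exact: continuous_set_val.
exact: cvg_snd.
Qed.

Lemma gpd_rng_continuous : continuous gpd_rng.
Proof.
apply: continuous_to_set_type.
apply: (@continuous_comp2 (gpd_arrow L) G (closedSet G) (closedSet G)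
  (fun a => (set_val a).1) (fun a => set_val (gpd_src a))
  (fun x C => translate x C)).
- exact: translate_continuous.
- exact: fst_arrow_continuous.
- move=> a; apply: (@continuous_comp _ _ _ gpd_src set_val).
    exact: gpd_src_continuous.
  exact: continuous_set_val.
Qed.

Lemma gpd_id_continuous : continuous gpd_id.
Proof.
apply: continuous_to_set_type.
apply: (@continuous_pair (discrete_hull L) G (discrete_hull L) (fun=> 1) id).
- exact: cst_continuous.
- by move=> P; exact: cvg_id.
Qed.

Lemma gpd_inv_continuous : continuous gpd_inv.
Proof.
apply: continuous_to_set_type.
apply: (@continuous_pair (gpd_arrow L) G (discrete_hull L)
  (fun a => (set_val a).1^-1) gpd_rng).
- move=> a; exact: (continuous_comp (@fst_arrow_continuous a)
    (@invg_continuous G _)).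
- exact: gpd_rng_continuous.
Qed.

Lemma gpd_mul_continuous : continuous gpd_mul.
Proof.
have f1 : continuous
    (fun ba : composable gpd_src gpd_rng => (set_val ba).1).
  move=> ba; apply: (@continuous_comp _ _ _ set_val fst).
    exact: continuous_set_val.
  exact: cvg_fst.
have f2 : continuous
    (fun ba : composable gpd_src gpd_rng => (set_val ba).2).
  move=> ba; apply: (@continuous_comp _ _ _ set_val snd).
    exact: continuous_set_val.
  exact: cvg_snd.
apply: continuous_to_set_type.
apply: (@continuous_pair (composable gpd_src gpd_rng) G (discrete_hull L)
  (fun ba => (set_val (set_val ba).1).1 * (set_val (set_val ba).2).1)
  (fun ba => gpd_src (set_val ba).2)).
- apply: (@continuous_comp2 (composable gpd_src gpd_rng) G G G
    (fun ba => (set_val (set_val ba).1).1)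
    (fun ba => (set_val (set_val ba).2).1) (fun a b => a * b)).
  + exact: mulg_continuous.
  + move=> ba; exact: (continuous_comp (f1 ba) (@fst_arrow_continuous _)).
  + move=> ba; exact: (continuous_comp (f2 ba) (@fst_arrow_continuous _)).
- move=> ba; exact: (continuous_comp (f2 ba) (@gpd_src_continuous _)).
Qed.

Lemma discrete_hull_hausdorff : hausdorff_space (discrete_hull L).
Proof. exact/set_type_hausdorff/closedSet_hausdorff. Qed.

Lemma discrete_hull_compact : compact [set: discrete_hull L].
Proof.
rewrite -(preimage_setT (@set_val _ (discrete_hull L))).
by apply: set_type_compact;
  [exact: closed_discrete_hull|exact: closedSet_compact].
Qed.

Lemma gpd_hausdorff : hausdorff_space (gpd_arrow L).
Proof.
by apply: set_type_hausdorff; apply: prod_hausdorff => //;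
  exact: discrete_hull_hausdorff.
Qed.

Lemma closed_gpd_arrow : closed (gpd_arrow L).
Proof.
have -> : gpd_arrow L = (fun xP : G * discrete_hull L =>
    translate xP.1 (set_val xP.2)) @^-1` (~` missing [set (1 : G)]).
  apply/seteqP; split => -[x P]; rewrite /gpd_arrow /missing /=.
    move=> Px /seteqP[+ _] => /(_ 1); apply; split => //.
    by apply/translateE; rewrite mulg1.
  by move=> /eqP/set0P[t [/translateE Px t1]]; move: Px; rewrite t1 mulg1.
apply: preimage_closed; last first.
  by apply: open_closedC; apply: open_missing; exact: compact_set1.
move=> xP _; move: xP.
apply: (@continuous_comp2 (G * discrete_hull L)%type G (closedSet G)
  (closedSet G) fst (fun xP => set_val xP.2) (fun x C => translate x C)).
- exact: translate_continuous.
- by move=> xP; exact: cvg_fst.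
- move=> xP; apply: (@continuous_comp _ _ _ snd set_val).
    exact: cvg_snd.
  exact: continuous_set_val.
Qed.

Lemma gpd_locally_compact : locally_compact [set: gpd_arrow L].
Proof.
move=> a _.
have [N [xN cN _]] := compact_nbhs_sub hG lcG (@filterT _ (nbhs (set_val a).1) _).
have cA : compact (@set_val _ (gpd_arrow L) @^-1` (N `*` setT)).
  apply: set_type_compact; first exact: closed_gpd_arrow.
  by apply: compact_setX => //; exact: discrete_hull_compact.
exists (@set_val _ (gpd_arrow L) @^-1` (N `*` setT)).
  have := @fst_arrow_continuous a _ xN.
  by apply: (@filterS _ (nbhs a)) => b Nb _; split.
by split => //; apply: compact_closed => //; exact: gpd_hausdorff.
Qed.

Definition point_set_groupoid : lchGroupoid :=
  @LCHGroupoid (discrete_hull L) (gpd_arrow L) gpd_src gpd_rng gpd_id gpd_inv gpd_mul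
    (fun=> erefl) gpd_rng_id (fun=> erefl) gpd_rng_inv
    (fun=> erefl) gpd_rng_mul gpd_mulA gpd_mul1g gpd_mulg1 gpd_mulVg gpd_mulgV
    gpd_src_continuous gpd_rng_continuous gpd_id_continuous gpd_inv_continuous
    gpd_mul_continuous gpd_hausdorff gpd_locally_compact.

End Groupoid.

(* Main.v *)
Require Import Defs.
From mathcomp Require Import all_boot all_order all_algebra.
From mathcomp Require Import all_classical all_reals all_analysis.
From mathcomp Require Import complex.

(** Finite local complexity, applied to compact sets containing the identity,
    makes the union of all [P] in the discrete hull locally finite. Hence the
    cocycle [(x, P) |-> x] from the groupoid to [G] is locally constant, and
    over a compact set it takes finitely many values. The indicator function of
    [x = y] on pairs [((x, P), (y, Q))] is therefore continuous and properly
    supported, it is [1] on the diagonal, and it is of positive type because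
    [x_i^-1 x_j = y_i^-1 y_j] if and only if
    [y_i x_i^-1 = y_j x_j^-1], an equivalence relation in [i] and [j]. *)

Set Implicit Arguments.
Unset Strict Implicit.
Unset Printing Implicit Defensive.
Import GRing.Theory Num.Theory.

Local Open Scope classical_set_scope.

(** The quadratic form splits over the classes of indices with equal [z] into a sum of squared
    moduli, one for the total of the [c j] in each class. *)
Lemma psdmx_kernel (R : realType) (T : eqType) (n : nat) (z : 'I_n -> T) :
  psdmx (\matrix_(i < n, j < n) ((z i == z j)%:R : R[i]))%R.
Proof.
move=> c.
(* A representative of the class of [i], so that classes are indexed by ['I_n] although [T] may be
   infinite. The default is never reached, since [i] itself qualifies; hence [r i] depends on [z i]
   alone. *)
pose r i := odflt i [pick k | z k == z i].
have zr i : z (r i) = z i.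
  by rewrite /r; case: pickP => [k /eqP //|/(_ i)]; rewrite eqxx.
have rE i j : (r i == r j) = (z i == z j).
  apply/eqP/eqP => [rij|zij]; first by rewrite -zr rij zr.
  by rewrite /r zij; case: pickP => [//|/(_ j)]; rewrite eqxx.
have -> : (\sum_i \sum_j (c i)^* * (\matrix_(i < n, j < n)
      ((z i == z j)%:R : R[i])) i j * c j
    = \sum_k (\sum_(j | r j == k) c j) * (\sum_(i | r i == k) c i)^*)%R.
  rewrite (partition_big r xpredT)//=; apply: eq_bigr => k _.
  rewrite rmorph_sum mulr_sumr; apply: eq_bigr => i /eqP ik.
  rewrite mulr_suml [RHS]big_mkcond; apply: eq_bigr => j _.
  rewrite mxE -rE ik eq_sym; case: eqP => _; first by rewrite mulr1 mulrC.
  by rewrite mulr0 mul0r.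
by apply: sumr_ge0 => k _; exact: mul_conjC_ge0.
Qed.

Lemma eq_mulVg_divg (G : groupType) (x x' y y' : G) :
  (x^-1 * x' == y^-1 * y')%g = (y / x == y' / x')%g.
Proof.
apply/eqP/eqP => h.
  by apply: (@mulIg _ x'); rewrite -mulgA h mulVKg mulgVK.
by apply: (@mulgI _ y); rewrite mulgA h mulgVK mulVKg.
Qed.

Section Cocycle.
Local Open Scope group_scope.
Variables (G : topologicalGroupType) (L : closedSet G).
Hypothesis hG : hausdorff_space G.
Hypothesis lcG : locally_compact [set: G].
Hypothesis flcL : finite_local_complexity L.

(** Adjoining [1] to [K] removes the unknown translation: if [1 = h a] and [y = h b] with [a], [b]
    in [E], then [y = a^-1 b], and there are finitely many choices of [E], [a] and [b]. *)
Lemma flc_locally_finite (K : set G) : compact K ->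
  finite_set (K `&` \bigcup_(P in discrete_hull L) (P : set G)).
Proof.
move=> cK.
have [F finF [Ffin FP]] := flcL (compactU cK (@compact_set1 G 1)).
apply: (@sub_finite_set _ _
  (\bigcup_(E in F) \bigcup_(a in E) [set a^-1 * x | x in E])).
  move=> y [Ky [P PL Py]]; have [h [E [FE KP]]] := FP _ PL.
  have [a Ea ha] : [set h * x | x in E] 1.
    by rewrite -KP; split; [right|exact: PL.2].
  have [b Eb hb] : [set h * x | x in E] y by rewrite -KP; split => //; left.
  exists E => //; exists a => //; exists b => //.
  rewrite -hb; congr (_ * b).
  by apply: (mulIg a); rewrite mulVg ha.
apply: bigcup_finite => // E /Ffin finE.
by apply: bigcup_finite => // a _; exact: finite_image.
Qed.

Definition cocycle (a : gpd_arrow L) : G := (set_val a).1.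

Lemma cocycle_continuous : continuous cocycle.
Proof.
move=> a; apply: (@continuous_comp _ _ _ set_val fst).
  exact: continuous_set_val.
exact: cvg_fst.
Qed.

Lemma cocycleV_hull (a : gpd_arrow L) :
  (\bigcup_(P in discrete_hull L) (P : set G)) (cocycle a)^-1.
Proof.
exists (set_val (set_val a).2); first exact: (set_mem (valP (gpd_src a))).
exact: (set_mem (valP a)).
Qed.

Lemma cocycle_locally_constant (a : gpd_arrow L) :
  \forall b \near a, cocycle b = cocycle a.
Proof.
have [N [aN cN _]] :=
  compact_nbhs_sub hG lcG (@filterT _ (nbhs (cocycle a)^-1) _).
(* The other candidates in [N] for the inverse of a cocycle value. They form a finite, hence closed,
   set, so avoiding them is an open condition. *)
pose S := (N `&` \bigcup_(P in discrete_hull L) (P : set G))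
  `\ (cocycle a)^-1.
have aNS : nbhs (cocycle a)^-1 (N `&` ~` S).
  apply: filterI => //; apply: open_nbhs_nbhs; split; last by move=> [_ []].
  apply: closed_openC; apply: accessible_finite_set_closed.1.
    exact: hausdorff_accessible.
  exact/finite_setD/flc_locally_finite.
have := continuous_comp (@cocycle_continuous a) (@invg_continuous G _).
move=> /(_ _ aNS); apply: (@filterS _ (nbhs a)) => b /= [Nb nSb].
apply: invg_inj; apply: contrapT => ab; apply: nSb; split => //.
by split => //; exact: cocycleV_hull.
Qed.

(** Properness of the cocycle: the arrows are closed in the product of [G] with the discrete hull,
    and the latter is compact. *)
Lemma cocycle_compact_preimage (K : set (gpd_arrow L)) : compact K ->
  compact (cocycle @^-1` (cocycle @` K)).
Proof.
move=> cK.
have cxK : compact (cocycle @` K).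
  apply: continuous_compact => //; apply: continuous_subspaceT.
  exact: cocycle_continuous.
have -> : cocycle @^-1` (cocycle @` K) = @set_val _ (gpd_arrow L) @^-1`
    ((cocycle @` K) `*` [set: discrete_hull L]).
  by apply/seteqP; split => [a Ka|a []].
apply: set_type_compact; first exact: closed_gpd_arrow.
by apply: compact_setX => //; exact: discrete_hull_compact.
Qed.

End Cocycle.

Section SameCocycle.
Variables (R : realType) (G : topologicalGroupType) (L : closedSet G).
Hypothesis hG : hausdorff_space G.
Hypothesis lcG : locally_compact [set: G].
Hypothesis flcL : finite_local_complexity L.
Let X := point_set_groupoid hG lcG L.

Definition same_cocycle (p : X * X) : R[i] :=
  (cocycle p.1 == cocycle p.2)%:R%R.

Lemma same_cocycle_locally_constant (p : X * X) :
  \forall q \near p, same_cocycle q = same_cocycle p.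
Proof.
case: p => a b.
exists ([set a' | cocycle a' = cocycle a], [set b' | cocycle b' = cocycle b]).
  by split; exact: cocycle_locally_constant.
by move=> [a' b'] [/= aa' bb']; rewrite /same_cocycle /= aa' bb'.
Qed.

Lemma same_cocycle_continuous : continuous (same_cocycle : X * X -> R[i]^o).
Proof.
by move=> p; apply: cvg_near_cst; exact: same_cocycle_locally_constant.
Qed.

(** The closure adds no points, because a locally constant function has a closed nonvanishing
    set. *)
Lemma supp_same_cocycle :
  supp same_cocycle = [set p | cocycle p.1 = cocycle p.2].
Proof.
apply/seteqP; split => [p|p pp]; last first.
  by apply: subset_closure; rewrite /= /same_cocycle pp eqxx oner_eq0.
move=> /(_ _ (same_cocycle_locally_constant p)) [q [/= q0 qp]].
move: q0; rewrite qp /same_cocycle.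
by case: (_ =P cocycle p.2); rewrite //= eqxx.
Qed.

(** On the support, one coordinate in [K] forces the cocycle of the other into the image of [K],
    hence that coordinate into a compact set. *)
Lemma same_cocycle_properly_supported : properly_supported same_cocycle.
Proof.
move=> K cK; have cK' := cocycle_compact_preimage hG lcG cK.
have clK := compact_closed (@garrow_hausdorff X) cK.
have cl1 : closed (K `*` [set: X]).
  have -> : K `*` [set: X] = fst @^-1` K by apply/seteqP; split => [p []|p].
  by apply: preimage_closed => // p _; exact: cvg_fst.
have cl2 : closed ([set: X] `*` K).
  have -> : [set: X] `*` K = snd @^-1` K by apply/seteqP; split => [p []|p].
  by apply: preimage_closed => // p _; exact: cvg_snd.
split.
- apply: (@subclosed_compact _ _
    (K `*` (@cocycle G L @^-1` (@cocycle G L @` K)))).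
  + by apply: closedI => //; exact: closed_closure.
  + exact: compact_setX.
  + rewrite supp_same_cocycle => p [/= pp [Kp _]].
    by split => //; exists p.1.
- apply: (@subclosed_compact _ _
    ((@cocycle G L @^-1` (@cocycle G L @` K)) `*` K)).
  + by apply: closedI => //; exact: closed_closure.
  + exact: compact_setX.
  + rewrite supp_same_cocycle => p [/= pp [_ Kp]].
    by split => //; exists p.2.
Qed.

Lemma same_cocycle_positive_type : positive_type same_cocycle.
Proof.
move=> x y n _ a b.
pose z i := (cocycle (set_val (b i)) * (cocycle (set_val (a i)))^-1)%g.
rewrite [X in psdmx X](_ : _ = \matrix_(i, j) (z i == z j)%:R)%R.
  exact: psdmx_kernel.
apply/matrixP => i j; rewrite !mxE.
by rewrite /same_cocycle /ldiv /composite /cocycle /= eq_mulVg_divg.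
Qed.

End SameCocycle.

Theorem theorem1 (R : realType) (G : topologicalGroupType)
  (hG : hausdorff_space G) (lcG : locally_compact [set: G])
  (scG : @second_countable G) (L : closedSet G)
  (flcL : finite_local_complexity L) :
  inner_amenable R (point_set_groupoid hG lcG L).
Proof.
(* A single function serves all [K] and [e], as it equals [1] on the whole diagonal. *)
move=> K e _ e0; exists (@same_cocycle R G L hG lcG); split.
- exact: same_cocycle_continuous.
- exact: same_cocycle_properly_supported.
- exact: same_cocycle_positive_type.
- by move=> a _; rewrite /same_cocycle eqxx subrr normr0 ltcR.
Qed.
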